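(* Let $\mathcal{V}=\{1,\dots,N\}$ and let $\{A(t)\}_{t\ge 0}$ ($t$ a non-negative integer) be a chain of $N\times N$ stochastic matrices in Class $\mathcal{P}^*$. Then $\{A(t)\}$ is class-ergodic if and only if it has the infinite jet-flow property over each island of $\{A(t)\}$. Moreover, if $\{A(t)\}$ is class-ergodic, then the islands of $\{A(t)\}$ are exactly its ergodic classes, and they are the jet-limits of the jets $J^1,\dots,J^c$ in the jet decomposition of $\{A(t)\}$; these limits are attained in finite time, i.e. there is $T\ge 0$ such that for all $t\ge T$ the sets $J^1(t),\dots,J^c(t)$ do not depend on $t$ and are exactly the islands of $\{A(t)\}$.
   Context: Time $t$ is discrete, $t=0,1,2,\dots$. A stochastic matrix is a row-stochastic matrix (non-negative entries, each row sums to $1$); $A(t)=[a_{ij}(t)]$. Class-ergodic: for every $t_0\ge 0$ the product $A(t)A(t-1)\cdots A(t_0)$ converges as $t\to\infty$. For a class-ergodic chain, $i,j\in\mathcal{V}$ belong to the same ergodic class if, for every $t_0\ge 0$, the difference of the $i$th and $j$th rows of $A(t)\cdots A(t_0)$ tends to $0$ as $t\to\infty$. Absolute probability sequence: a sequence $\{\pi(t)\}_{t\ge0}$ of probability vectors in $\mathbb{R}^N$ with $\pi'(t+1)A(t)=\pi'(t)$ for all $t\ge0$ (prime is transpose). The chain is in Class $\mathcal{P}^*$ if it admits an absolute probability sequence for which there is $p^*>0$ with $\pi_i(t)\ge p^*$ for all $i\in\mathcal{V}$, $t\ge0$. Infinite flow graph: the undirected graph on $\mathcal{V}$ in which distinct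 $i,j$ are joined iff $\sum_{t=0}^\infty (a_{ij}(t)+a_{ji}(t))=\infty$. The vertex sets of its connected components are the islands of $\{A(t)\}$. Jets: for $\mathcal{V}'\subseteq\mathcal{V}$, a jet $J$ in $\mathcal{V}'$ is a sequence $\{J(t)\}_{t\ge0}$ of subsets of $\mathcal{V}'$; it is proper if $\emptyset\ne J(t)\subsetneq\mathcal{V}'$ for all $t\ge0$. $\mathcal{V}'\backslash J$ denotes the jet $\{\mathcal{V}'\backslash J(t)\}$. The jet-limit of $J$ is the limit of $\{J(t)\}$, if it exists, in the sense that the sequence becomes constant after a finite time. A tuple of jets $(J^1,\dots,J^c)$ is a jet-partition of $\mathcal{V}$ if $(J^1(t),\dots,J^c(t))$ is a partition of $\mathcal{V}$ for every $t$. For two disjoint jets (disjoint at each time), $$U(J^s,J^k)=\sum_{t=0}^\infty\Big[\sum_{i\in J^s(t+1)}\sum_{j\in J^k(t)}a_{ij}(t)+\sum_{i\in J^k(t+1)}\sum_{j\in J^s(t)}a_{ij}(t)\Big]\in[0,\infty].$$ The chain has the infinite jet-flow property over $\mathcal{V}'$ if $U(J,\mathcal{V}'\backslash J)=\infty$ for every proper jet $J$ in $\mathcal{V}'$. Jet decomposition (from Sonin's Decomposition-Separation theorem, for a chain in Class $\mathcal{P}^*$ with $\{\pi(t)\}$ an absolute probability sequence uniformly bounded away from zero): with $r_{ij}(t)=\pi_j(t+1)a_{ji}(t)$ and $$V(J^s,J^k)=\sum_{t=0}^\infty\Big[\sum_{i\in J^k(t)}\sum_{j\in J^s(t+1)}r_{ij}(t)+\sum_{i\in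 J^s(t)}\sum_{j\in J^k(t+1)}r_{ij}(t)\Big],$$ the jet decomposition is a jet-partition $(J^1,\dots,J^c)$ of $\mathcal{V}$, $1\le c\le N$, such that: (i) for each $k$, $\sum_{i\in J^k(t)}\pi_i(t)$ converges as $t\to\infty$ to a constant $\pi_k^*>0$, and for every initial time $\tau\ge 0$ and initial state $x(\tau)\in\mathbb{R}^N$, the solution of $x(t+1)=A(t)x(t)$, $t\ge\tau$, satisfies: there is $x_k^*$ (depending on $\tau,x(\tau)$) with $\lim_{t\to\infty}x_{i_t}(t)=x_k^*$ for every sequence $\{i_t\}$ with $i_t\in J^k(t)$; (ii) $V(J^k,J^s)<\infty$ for all $k\ne s$. By Sonin's theorem such a decomposition exists and is unique up to jets $J$ with $\lim_{t\to\infty}\sum_{i\in J(t)}\pi_i(t)=0$ and $V(J,\mathcal{V}\backslash J)<\infty$. (In general Sonin's theorem also involves a jet $J^0$ whose total $\pi$-mass tends to $0$; it is absent for chains in Class $\mathcal{P}^*$.) *)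

(* Defs.v *)
From HB Require Import structures.
From mathcomp Require Import all_boot all_order all_algebra.
From mathcomp Require Import all_classical all_reals all_analysis.

Set Implicit Arguments.
Unset Strict Implicit.
Unset Printing Implicit Defensive.

Import Order.TTheory GRing.Theory Num.Theory.
Import numFieldTopology.Exports numFieldNormedType.Exports.

Local Open Scope classical_set_scope.
Local Open Scope ring_scope.

Section Chains.
Context {R : realType} {N : nat}.
Implicit Types (A : nat -> 'M[R]_N) (pi : nat -> 'cV[R]_N).

Definition stochastic (M : 'M[R]_N) : Prop :=
  (forall i j, 0 <= M i j) /\ (forall i, \sum_j M i j = 1).

(* [backward_prod A t0 n] is A(t0 + n - 1) ... A(t0 + 1) A(t0), a product of n
   factors: the limit n -> oo is the limit t -> oo of A(t) ... A(t0). *)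
Fixpoint backward_prod A (t0 n : nat) : 'M[R]_N :=
  if n is n'.+1 then A (t0 + n')%N *m backward_prod A t0 n' else 1%:M.

Definition class_ergodic A : Prop :=
  forall t0, cvgn (backward_prod A t0).

Definition same_ergodic_class A (i j : 'I_N) : Prop :=
  forall t0, (fun n => row i (backward_prod A t0 n) -
                       row j (backward_prod A t0 n)) @ \oo --> (0 : 'rV[R]_N).

Definition ergodic_classes A : {set {set 'I_N}} :=
  equivalence_partition (fun i j => `[< same_ergodic_class A i j >])
    [set: 'I_N]%SET.

Definition probability_vector (p : 'cV[R]_N) : Prop :=
  (forall i, 0 <= p i 0) /\ \sum_i p i 0 = 1.

Definition absolute_probability_sequence A pi : Prop :=
  (forall t, probability_vector (pi t)) /\
  (forall t, (pi t.+1)^T *m A t = (pi t)^T).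

Definition uniformly_bounded_away_from_zero pi : Prop :=
  exists2 p : R, 0 < p & forall t i, p <= pi t i 0.

Definition class_Pstar A : Prop :=
  exists2 pi, absolute_probability_sequence A pi &
              uniformly_bounded_away_from_zero pi.

Definition infinite_flow_edge A : rel 'I_N := fun i j =>
  (i != j) && ((\sum_(0 <= t <oo) (A t i j + A t j i)%:E)%E == +oo%E).

Definition islands A : {set {set 'I_N}} :=
  equivalence_partition (connect (infinite_flow_edge A)) [set: 'I_N]%SET.

Definition jet : Type := nat -> {set 'I_N}.

Definition proper_jet (W : {set 'I_N}) (J : jet) : Prop :=
  forall t, J t != finset.set0 /\ J t \proper W.

Definition jet_compl (W : {set 'I_N}) (J : jet) : jet :=
  fun t => W :\: J t.

Definition jet_limit (J : jet) (L : {set 'I_N}) : Prop :=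
  exists T, forall t, (T <= t)%N -> J t = L.

Definition jet_flow_U A (Js Jk : jet) : \bar R :=
  (\sum_(0 <= t <oo)
    (\sum_(i in Js t.+1) \sum_(j in Jk t) A t i j +
     \sum_(i in Jk t.+1) \sum_(j in Js t) A t i j)%R%:E)%E.

Definition infinite_jet_flow A (W : {set 'I_N}) : Prop :=
  forall J, proper_jet W J -> jet_flow_U A J (jet_compl W J) = +oo%E.

Definition flow_r A pi (t : nat) (i j : 'I_N) : R := pi t.+1 j 0 * A t j i.

Definition jet_flow_V A pi (Js Jk : jet) : \bar R :=
  (\sum_(0 <= t <oo)
    (\sum_(i in Jk t) \sum_(j in Js t.+1) flow_r A pi t i j +
     \sum_(i in Js t) \sum_(j in Jk t.+1) flow_r A pi t i j)%R%:E)%E.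

(* [finset.partition] makes every block nonempty; injectivity makes the blocks of the
   tuple pairwise distinct, hence pairwise disjoint. *)
Definition jet_partition (c : nat) (J : 'I_c -> jet) : Prop :=
  forall t, injective (fun k => J k t) /\
            finset.partition [set J k t | k : 'I_c]%SET [set: 'I_N]%SET.

Definition solution_from A (tau : nat) (x : nat -> 'cV[R]_N) : Prop :=
  forall t, (tau <= t)%N -> x t.+1 = A t *m x t.

Definition jet_decomposition A pi (c : nat) (J : 'I_c -> jet) : Prop :=
  [/\ (1 <= c <= N)%N,
      jet_partition J,
      forall k,
        (exists2 pik : R, 0 < pik &
           (fun t => \sum_(i in J k t) pi t i 0) @ \oo --> pik) /\
        (forall tau x, solution_from A tau x ->
           exists xk : R, forall i : nat -> 'I_N,
             (forall t, i t \in J k t) ->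
             (fun t => x t (i t) 0) @ \oo --> xk) &
      forall k s, k != s -> (jet_flow_V A pi (J k) (J s) < +oo)%E].

End Chains.

Arguments jet : clear implicits.

(* Main.v *)
Require Import Defs.
From HB Require Import structures.
From mathcomp Require Import all_boot all_order all_algebra.
From mathcomp Require Import all_classical all_reals all_analysis.
From mathcomp Require Import lra ring.

Set Implicit Arguments.
Unset Strict Implicit.
Unset Printing Implicit Defensive.

Import Order.TTheory GRing.Theory Num.Theory.
Import numFieldTopology.Exports numFieldNormedType.Exports.

Local Open Scope classical_set_scope.
Local Open Scope ring_scope.

(** A solution of x(t+1) = A(t) x(t) is a backward martingale for an absolute
    probability sequence pi: the pi-average of any convex function of the values
    is nonincreasing in time. When pi is bounded below by a positive constant
    this has two consequences. With the square, the squared jumps, weighted by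
    the entries of A(t), are summable ([bounded_jumps]). With x |-> |x - c|, the
    pi-average of every tent function converges; a tent whose interval is
    visited infinitely often keeps a positive average, so that its interval is
    eventually always occupied. As there are only N values, one of N+1 disjoint
    intervals is eventually free of values ([eventual_gap]).

    Independently of pi, a jet that receives finite flow from outside confines
    the indicator started on it late enough ([confinement], [jet_separation]);
    this applies to islands and their complements.

    If the chain is class-ergodic, summable jumps force equal limits at the ends
    of an edge of the infinite flow graph, and confinement separates distinct
    islands, so the islands are the ergodic classes. A proper jet of an island
    with finite flow to its complement would be confined as well, against the
    consensus inside the island: the infinite jet-flow property holds.

    If the property holds on the islands, the minimum and the maximum of a
    solution over an island converge, since islands exchange finite flow. Were
    the limits distinct, a gap between them would give a level such that the
    states above it form a proper jet; every crossing is a jump of size bounded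
    below, so the flow of that jet is finite, a contradiction
    ([island_limits_eq]).

    For the jet decomposition, constant jets equal to the islands qualify.
    In any decomposition, the values of the indicator of an island have a common
    limit along each jet, so that each jet is eventually inside one island
    ([jet_side]); two jets in one island would give a proper jet with finite
    flow, so each island is eventually a single jet. *)

(** * Series with bounded partial sums *)

Section BoundedSums.
Context {R : realType}.
Implicit Types (f g u : nat -> R).

(** Boundedness of the partial sums; for nonnegative terms, summability. *)
Definition bounded_sums f : Prop :=
  exists C : R, forall n, \sum_(0 <= k < n) f k <= C.

Lemma nneseries_ltyP f : (forall n, 0 <= f n) ->
  (\sum_(0 <= t <oo) (f t)%:E < +oo)%E <-> bounded_sums f.
Proof.
move=> f0.
split=> [flt|[C fC]].
  have ffin : (\sum_(0 <= t <oo) (f t)%:E)%E \is a fin_num.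
    by rewrite ge0_fin_numE //; apply: nneseries_ge0 => n _; rewrite lee_fin.
  exists (fine (\sum_(0 <= t <oo) (f t)%:E)%E) => n.
  rewrite -lee_fin fineK // -sumEFin.
  by apply: nneseries_lim_ge => k _; rewrite lee_fin.
apply: (@le_lt_trans _ _ C%:E); last by rewrite ltry.
apply: lime_le; first by apply: is_cvg_nneseries => n _; rewrite lee_fin.
by apply: nearW => n; rewrite sumEFin lee_fin.
Qed.

Lemma bounded_sums_le f g : (forall n, f n <= g n) ->
  bounded_sums g -> bounded_sums f.
Proof.
move=> fg [C gC]; exists C => n; apply: le_trans (gC n).
by apply: ler_sum => k _.
Qed.

Lemma bounded_sumsD f g : bounded_sums f -> bounded_sums g ->
  bounded_sums (fun n => f n + g n).
Proof.
move=> [C fC] [D gD]; exists (C + D) => n.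
by rewrite big_split lerD.
Qed.

Lemma bounded_sumsZ (a : R) f : 0 <= a -> bounded_sums f ->
  bounded_sums (fun n => a * f n).
Proof.
by move=> a0 [C fC]; exists (a * C) => n; rewrite -mulr_sumr ler_wpM2l.
Qed.

Lemma bounded_sums_sum (I : finType) (P : pred I) (F : I -> nat -> R) :
  (forall i, P i -> bounded_sums (F i)) ->
  bounded_sums (fun n => \sum_(i | P i) F i n).
Proof.
move=> FP.
have /choice[C HC] : forall i, exists C : R, P i ->
    forall n, \sum_(0 <= k < n) F i k <= C.
  move=> i; case: (boolP (P i)) => [/FP[C FC]|_]; first by exists C.
  by exists 0.
exists (\sum_(i | P i) C i) => n; rewrite exchange_big /=.
by apply: ler_sum => i Pi; exact: HC.
Qed.

Lemma sum_nat_addn T n f : \sum_(0 <= k < T + n) f k =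
  \sum_(0 <= k < T) f k + \sum_(0 <= k < n) f (T + k)%N.
Proof.
rewrite (@big_cat_nat _ _ _ T 0 (T + n)) ?leq_addr //=; congr (_ + _).
have := @big_addn _ 0 +%R 0 (T + n) T xpredT f; rewrite add0n addKn => ->.
by apply: eq_bigr => i _; rewrite addnC.
Qed.

Lemma bounded_sums_shift T f : (forall n, 0 <= f n) ->
  bounded_sums (fun n => f (T + n)%N) <-> bounded_sums f.
Proof.
move=> f0; split=> [[C fC]|[C fC]].
  exists (\sum_(0 <= k < T) f k + C) => n.
  apply: (@le_trans _ _ (\sum_(0 <= k < T + n) f k)).
    rewrite (@big_cat_nat _ _ _ n 0 (T + n)) ?leq_addl //= lerDl.
    by apply: sumr_ge0 => k _.
  by rewrite sum_nat_addn lerD2l.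
exists C => n; apply: le_trans (fC (T + n)%N).
by rewrite sum_nat_addn lerDr; apply: sumr_ge0 => k _.
Qed.

Lemma bounded_sums_near f g T : (forall n, 0 <= f n) -> (forall n, 0 <= g n) ->
  (forall n, (T <= n)%N -> f n <= g n) -> bounded_sums g -> bounded_sums f.
Proof.
move=> f0 g0 fg gb; apply/(bounded_sums_shift T f0).
apply: bounded_sums_le (proj2 (bounded_sums_shift T g0) gb) => n.
by apply: fg; rewrite leq_addr.
Qed.

(** A sequence whose increments are bounded above by summable terms is, up to
    the convergent partial sums of these, nonincreasing. *)
Lemma quasi_nonincreasing_is_cvgn u f (m : R) : (forall n, 0 <= f n) ->
  bounded_sums f -> (forall n, m <= u n) -> (forall n, u n.+1 <= u n + f n) ->
  cvgn u.
Proof.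
move=> f0 [C fC] mu uf.
pose s n := \sum_(0 <= k < n) f k.
have sS n : s n.+1 = s n + f n by rewrite /s big_nat_recr.
have cs : cvgn s.
  apply: nondecreasing_is_cvgn; last by exists C => _ [n _ <-]; exact: fC.
  by apply/nondecreasing_seqP => n; rewrite sS lerDl.
have cus : cvgn (fun n => u n - s n).
  apply: nonincreasing_is_cvgn.
    by apply/nonincreasing_seqP => n; rewrite sS; have := uf n; lra.
  exists (m - C) => _ [n _ <-].
  by have := mu n; have := fC n; rewrite -/(s n); lra.
rewrite (_ : u = (fun n => u n - s n) \+ s).
  exact: is_cvgD.
by apply/funext => n /=; rewrite subrK.
Qed.

Lemma bounded_sums_tail f (e : R) : (forall n, 0 <= f n) -> bounded_sums f ->
  0 < e -> exists T, forall t n, (T <= t)%N ->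
    \sum_(0 <= k < n) f (t + k)%N <= e.
Proof.
move=> f0 [C fC] e0.
pose s n := \sum_(0 <= k < n) f k.
have nds : nondecreasing_seq s.
  by apply/nondecreasing_seqP => n; rewrite /s big_nat_recr //= lerDl.
have cs : cvgn s.
  by apply: nondecreasing_is_cvgn => //; exists C => _ [n _ <-]; exact: fC.
have sl n : s n <= limn s by exact: nondecreasing_cvgn_le.
have [T _ HT] : \forall n \near \oo, limn s - e < s n.
  by apply: (cvgr_gt (limn s)) => //; rewrite ltrBlDr ltrDl.
exists T => t n Tt; have := HT t Tt; have := sl (t + n)%N.
rewrite /s sum_nat_addn; lra.
Qed.

End BoundedSums.

(** * Entrywise convergence of matrices *)

Lemma cvg_mxP {R : realType} {m n : nat} (u : nat -> 'M[R]_(m, n))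
    (M : 'M[R]_(m, n)) :
  u @ \oo --> M <-> forall i j, (fun k => u k i j) @ \oo --> M i j.
Proof.
split=> [uM i j|uM].
  apply: (@cvg_comp _ _ _ u (fun N : 'M[R]_(m, n) => N i j) _ _ _ uM).
  exact: coord_continuous.
move=> B [P MP PB]; rewrite nbhs_filterE /=.
have : \forall k \near \oo, forall i j, P i j (u k i j).
  apply: (filter_forall (F := \oo)) => i.
  apply: (filter_forall (F := \oo)) => j.
  exact: uM (MP i j).
by apply: filterS => k; exact: PB.
Qed.

(** * Flows between sets of states *)

Section Inflow.
Context {R : realType} {N : nat}.
Implicit Types (M : 'M[R]_N) (S T : {set 'I_N}).

Definition nonneg_mx M : Prop := forall i j, 0 <= M i j.

(** Total weight that the rows in [S] put on the columns in [T]. *)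
Definition inflow M S T : R := \sum_(i in S) \sum_(j in T) M i j.

Lemma inflow_ge0 M S T : nonneg_mx M -> 0 <= inflow M S T.
Proof. by move=> M0; apply: sumr_ge0 => i _; apply: sumr_ge0 => j _. Qed.

Lemma inflow_tr M S T : inflow M^T S T = inflow M T S.
Proof.
rewrite /inflow exchange_big; apply: eq_bigr => i _.
by apply: eq_bigr => j _; rewrite mxE.
Qed.

Lemma sum_subset_le (F : 'I_N -> R) S T : (forall i, 0 <= F i) ->
  S \subset T -> \sum_(i in S) F i <= \sum_(i in T) F i.
Proof.
move=> F0 /fintype.subsetP ST.
rewrite big_mkcond [leRHS]big_mkcond /=; apply: ler_sum => i _.
by case: ifPn => [/ST ->//|_]; case: ifP.
Qed.

Lemma inflow_mono M S S' T T' : nonneg_mx M -> S \subset S' -> T \subset T' ->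
  inflow M S T <= inflow M S' T'.
Proof.
move=> M0 SS TT; apply: (@le_trans _ _ (inflow M S' T)).
  by apply: sum_subset_le => // i; apply: sumr_ge0.
by apply: ler_sum => i _; exact: sum_subset_le.
Qed.

Lemma inflow_bigcupr M S (I : finType) (P : pred I) (F : I -> {set 'I_N}) :
  nonneg_mx M ->
  inflow M S (\bigcup_(k | P k) F k)%SET <= \sum_(k | P k) inflow M S (F k).
Proof.
move=> M0; rewrite /inflow [leRHS]exchange_big /=; apply: ler_sum => i _.
under [leRHS]eq_bigr => k _ do rewrite big_mkcond /=.
rewrite exchange_big big_mkcond /=; apply: ler_sum => j _.
case: ifPn => [/bigcupP[k Pk jk]|_].
  rewrite (bigD1 k) //= jk lerDl; apply: sumr_ge0 => l _.
  by case: ifP.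
by apply: sumr_ge0 => l _; case: ifP.
Qed.

Lemma inflow_bigcupl M T (I : finType) (P : pred I) (F : I -> {set 'I_N}) :
  nonneg_mx M ->
  inflow M (\bigcup_(k | P k) F k)%SET T <= \sum_(k | P k) inflow M (F k) T.
Proof.
move=> M0; rewrite -inflow_tr.
under [leRHS]eq_bigr => k _ do rewrite -inflow_tr.
by apply: inflow_bigcupr => i j; rewrite mxE.
Qed.

Lemma inflow_setUr M S T T' : nonneg_mx M ->
  inflow M S (T :|: T') <= inflow M S T + inflow M S T'.
Proof.
move=> M0; rewrite /inflow -big_split /=; apply: ler_sum => i _.
rewrite big_mkcond [X in _ <= X + _]big_mkcond [X in _ <= _ + X]big_mkcond /=.
rewrite -big_split /=; apply: ler_sum => j _; have := M0 i j.
by rewrite finset.in_setU; case: (j \in T); case: (j \in T') => /=; lra.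
Qed.

End Inflow.

(** * Solutions of the averaging dynamics *)

Section Dynamics.
Context {R : realType} {N : nat}.
Implicit Types (A : nat -> 'M[R]_N) (x : nat -> 'I_N -> R).

(** Solutions of x(t+1) = A(t) x(t), in coordinates and with time counted from
    the initial time [t0]. *)
Definition trajectory A t0 x : Prop :=
  forall n i, x n.+1 i = \sum_j A (t0 + n)%N i j * x n j.

(** Weight that row [i] of the product of [n] factors puts on [S]: the
    solution started at time [t0] from the indicator of [S]. *)
Definition prod_weight A t0 (S : {set 'I_N}) n i : R :=
  \sum_(j in S) backward_prod A t0 n i j.

Lemma stochastic_nonneg (M : 'M[R]_N) : stochastic M -> nonneg_mx M.
Proof. by case. Qed.

Lemma stochastic_backward_prod A t0 n : (forall t, stochastic (A t)) ->
  stochastic (backward_prod A t0 n).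
Proof.
move=> hA; elim: n => [|n [B0 B1]] /=.
  split=> [i j|i]; first by rewrite mxE; case: (_ == _).
  rewrite (bigD1 i) //= big1 ?addr0 ?mxE ?eqxx // => j ji.
  by rewrite mxE eq_sym (negPf ji).
have [M0 M1] := hA (t0 + n)%N; split=> [i j|i].
  by rewrite mxE; apply: sumr_ge0 => k _; rewrite mulr_ge0.
under eq_bigr => j _ do rewrite mxE.
rewrite exchange_big /= -[RHS](M1 i); apply: eq_bigr => k _.
by rewrite -mulr_sumr B1 mulr1.
Qed.

Lemma prod_weight_trajectory A t0 S : trajectory A t0 (prod_weight A t0 S).
Proof.
move=> n i; rewrite /prod_weight.
under [RHS]eq_bigr => j _ do rewrite mulr_sumr.
by rewrite exchange_big /=; apply: eq_bigr => j _; rewrite mxE.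
Qed.

Lemma prod_weight0 A t0 S i : prod_weight A t0 S 0 i = (i \in S)%:R.
Proof.
rewrite /prod_weight /=; case: (boolP (i \in S)) => iS.
  rewrite (bigD1 i) //= big1 ?addr0 ?mxE ?eqxx // => j /andP[_ ji].
  by rewrite mxE eq_sym (negPf ji).
rewrite big1 // => j jS; rewrite mxE; case: eqP => // ij.
by rewrite ij jS in iS.
Qed.

Lemma prod_weightC A t0 S n i : (forall t, stochastic (A t)) ->
  prod_weight A t0 (~: S) n i = 1 - prod_weight A t0 S n i.
Proof.
move=> /(stochastic_backward_prod t0 n)[_ /(_ i) B1].
apply/eqP; rewrite eq_sym subr_eq -B1 addrC (bigID (mem S)) /=; apply/eqP.
by congr (_ + _); apply: eq_bigl => j; rewrite finset.in_setC.
Qed.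

Lemma prod_weight_ge0 A t0 S n i : (forall t, stochastic (A t)) ->
  0 <= prod_weight A t0 S n i.
Proof.
by move=> /(stochastic_backward_prod t0 n)[B0 _]; exact: sumr_ge0.
Qed.

Lemma solution_prod A tau (x : nat -> 'cV[R]_N) n :
  solution_from A tau x -> x (tau + n)%N = backward_prod A tau n *m x tau.
Proof.
move=> xs; elim: n => [|n IHn]; first by rewrite addn0 mul1mx.
by rewrite addnS xs ?leq_addr // IHn mulmxA.
Qed.

(** A convex combination loses at most the weight put outside [S], the values
    on [S] being at least [a]. *)
Lemma step_lower (M : 'M[R]_N) (y : 'I_N -> R) (a : R) (S : {set 'I_N}) i :
  stochastic M -> (forall j, 0 <= y j) -> a <= 1 ->
  (forall j, j \in S -> a <= y j) ->
  a - \sum_(j in ~: S) M i j <= \sum_j M i j * y j.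
Proof.
move=> [M0 M1] y0 a1 aS.
rewrite -[a in a - _]mul1r -(M1 i) mulr_suml [X in _ - X]big_mkcond -sumrB /=.
apply: ler_sum => j _; rewrite finset.in_setC.
case: (boolP (j \in S)) => [/aS ay|_] /=.
  by rewrite subr0; apply: ler_wpM2l.
rewrite -[X in _ - X]mulr1 -mulrBr; apply: ler_wpM2l => //.
by have := y0 j; lra.
Qed.

(** Weight entering the jet [J] at time [t] from outside. *)
Definition leak A (J : jet N) t : R := inflow (A t) (J t.+1) (~: J t).

Lemma leak_ge0 A J t : (forall t, stochastic (A t)) -> 0 <= leak A J t.
Proof. by move=> hA; apply/inflow_ge0/stochastic_nonneg. Qed.

(** A nonnegative solution that is at least 1 on [J] initially falls below 1 on
    [J] by no more than the weight that has entered [J]. *)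
Lemma confinement A t0 x (J : jet N) : (forall t, stochastic (A t)) ->
  trajectory A t0 x -> (forall n i, 0 <= x n i) ->
  (forall i, i \in J t0 -> 1 <= x 0%N i) ->
  forall n i, i \in J (t0 + n)%N ->
    1 - \sum_(0 <= k < n) leak A J (t0 + k)%N <= x n i.
Proof.
move=> hA xt x0 x1; elim=> [|n IHn] i.
  by rewrite addn0 big_geq // subr0 => /x1.
rewrite addnS => iJ; rewrite xt.
apply: le_trans (step_lower i (hA _) (x0 n) _ IHn).
  rewrite big_nat_recr //= opprD addrA lerD2l lerN2 /leak /inflow.
  rewrite [leRHS](bigD1 i) //= lerDl; apply: sumr_ge0 => k _.
  by apply: sumr_ge0 => j _; case: (hA (t0 + n)%N).
by rewrite gerBl; apply: sumr_ge0 => k _; exact: leak_ge0.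
Qed.

(** Two disjoint jets receiving finite flow from outside stay apart: the
    indicator of [J] at a late enough time remains almost an indicator. *)
Lemma jet_separation A (J K : jet N) (e : R) : (forall t, stochastic (A t)) ->
  0 < e -> (forall t, K t \subset ~: J t) ->
  bounded_sums (leak A J) -> bounded_sums (leak A K) ->
  exists T, forall t0, (T <= t0)%N -> forall n,
    (forall i, i \in J (t0 + n)%N -> 1 - e <= prod_weight A t0 (J t0) n i) /\
    (forall i, i \in K (t0 + n)%N -> prod_weight A t0 (J t0) n i <= e).
Proof.
move=> hA e0 JK lJ lK.
have [T1 HT1] := bounded_sums_tail (fun t => leak_ge0 J t hA) lJ e0.
have [T2 HT2] := bounded_sums_tail (fun t => leak_ge0 K t hA) lK e0.
exists (maxn T1 T2) => t0; rewrite geq_max => /andP[Tt1 Tt2] n; split=> i iJ.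
  apply: le_trans (confinement hA (prod_weight_trajectory A t0 (J t0))
    (fun n i => prod_weight_ge0 t0 (J t0) n i hA) _ iJ).
    by rewrite lerD2l lerN2 HT1.
  by move=> j jJ; rewrite prod_weight0 jJ.
have := confinement hA (prod_weight_trajectory A t0 (~: J t0))
    (fun n i => prod_weight_ge0 t0 (~: J t0) n i hA) _ iJ.
rewrite prod_weightC // => H.
have {}H : 1 - \sum_(0 <= k < n) leak A K (t0 + k)%N
    <= 1 - prod_weight A t0 (J t0) n i.
  apply: H => j jK; rewrite prod_weight0.
  by rewrite (fintype.subsetP (JK t0) _ jK).
by have := HT2 t0 n Tt2; lra.
Qed.

End Dynamics.

(** * Dissipation along an absolute probability sequence *)

Section Dissipation.
Context {R : realType} {N : nat}.
Implicit Types (A : nat -> 'M[R]_N) (pi : nat -> 'cV[R]_N).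
Implicit Types (x : nat -> 'I_N -> R).

Lemma absolute_probability_avg A pi t (f : 'I_N -> R) :
  absolute_probability_sequence A pi ->
  \sum_j pi t j 0 * f j = \sum_i pi t.+1 i 0 * \sum_j A t i j * f j.
Proof.
move=> [_ /(_ t) e].
under [RHS]eq_bigr => i _ do rewrite mulr_sumr.
rewrite exchange_big /=; apply: eq_bigr => j _.
have -> : pi t j 0 = ((pi t.+1)^T *m A t) 0 j by rewrite e mxE.
rewrite mxE mulr_suml; apply: eq_bigr => i _.
by rewrite mxE mulrA.
Qed.

Lemma abs_prob_ge0 A pi t i : absolute_probability_sequence A pi ->
  0 <= pi t i 0.
Proof. by case=> /(_ t)[]. Qed.

Lemma abs_prob_le1 A pi t i : absolute_probability_sequence A pi ->
  pi t i 0 <= 1.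
Proof.
case=> /(_ t)[p0 p1] _; rewrite -p1 (bigD1 i) //= lerDl.
by apply: sumr_ge0.
Qed.

(** Squared jumps from the values at step [n] to those at step [n.+1], weighted
    by the entries of the matrix and summed. *)
Definition jump A t0 x n : R :=
  \sum_i \sum_j A (t0 + n)%N i j * (x n j - x n.+1 i) ^+ 2.

Lemma jump_ge0 A t0 x n : (forall t, stochastic (A t)) -> 0 <= jump A t0 x n.
Proof.
move=> hA; apply: sumr_ge0 => i _; apply: sumr_ge0 => j _.
by rewrite mulr_ge0 ?sqr_ge0 //; case: (hA (t0 + n)%N).
Qed.

(** The variance identity: the second moment of the values under pi decreases
    by the pi-weighted squared jumps, which are therefore summable. *)
Lemma bounded_jumps A pi (p : R) t0 x : (forall t, stochastic (A t)) ->
  absolute_probability_sequence A pi -> 0 < p -> (forall t i, p <= pi t i 0) ->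
  trajectory A t0 x -> bounded_sums (jump A t0 x).
Proof.
move=> hA hpi p0 hp xt.
pose E n := \sum_i pi (t0 + n)%N i 0 * x n i ^+ 2.
have E0 n : 0 <= E n.
  apply: sumr_ge0 => i _.
  by rewrite mulr_ge0 ?sqr_ge0 // (abs_prob_ge0 _ _ hpi).
have step n : p * jump A t0 x n <= E n - E n.+1.
  rewrite /E (absolute_probability_avg _ _ hpi) addnS -sumrB mulr_sumr.
  apply: ler_sum => i _; rewrite -mulrBr.
  have -> : \sum_j A (t0 + n)%N i j * x n j ^+ 2 - x n.+1 i ^+ 2 =
            \sum_j A (t0 + n)%N i j * (x n j - x n.+1 i) ^+ 2.
    have e j : A (t0 + n)%N i j * (x n j - x n.+1 i) ^+ 2 =
        A (t0 + n)%N i j * x n j ^+ 2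
        - (A (t0 + n)%N i j * x n j) * (2 * x n.+1 i)
        + A (t0 + n)%N i j * x n.+1 i ^+ 2 by ring.
    under [RHS]eq_bigr => j _ do rewrite e.
    rewrite big_split sumrB /= -!mulr_suml -xt (proj2 (hA (t0 + n)%N)).
    ring.
  apply: ler_wpM2r => //; apply: sumr_ge0 => j _.
  by rewrite mulr_ge0 ?sqr_ge0 //; case: (hA (t0 + n)%N).
exists (E 0%N / p) => n; rewrite ler_pdivlMr // mulrC mulr_sumr.
apply: (@le_trans _ _ (E 0%N - E n)); last by rewrite gerBl.
elim: n => [|n IHn]; first by rewrite big_geq // subrr.
by rewrite big_nat_recr //=; have := step n; lra.
Qed.

(** By the triangle inequality, the pi-average of the distances to [c] is
    nonincreasing along a solution. *)
Lemma abs_deviation_is_cvgn A pi t0 x c : (forall t, stochastic (A t)) ->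
  absolute_probability_sequence A pi -> trajectory A t0 x ->
  cvgn (fun n => \sum_i pi (t0 + n)%N i 0 * `|x n i - c|).
Proof.
move=> hA hpi xt; apply: nonincreasing_is_cvgn.
  apply/nonincreasing_seqP => n.
  rewrite [leRHS](absolute_probability_avg _ _ hpi) addnS.
  apply: ler_sum => i _.
  apply: ler_wpM2l; first exact: abs_prob_ge0 hpi.
  have [M0 M1] := hA (t0 + n)%N.
  have -> : x n.+1 i - c = \sum_j A (t0 + n)%N i j * (x n j - c).
    under eq_bigr => j _ do rewrite mulrBr.
    by rewrite sumrB -mulr_suml M1 mul1r xt.
  apply: le_trans (ler_norm_sum _ _ _) _; apply: ler_sum => j _.
  by rewrite normrM ger0_norm.
exists 0 => _ [n _ <-]; apply: sumr_ge0 => i _.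
by rewrite mulr_ge0 // (abs_prob_ge0 _ _ hpi).
Qed.

(** Tent function of height and half-width [w] centred at [c]. *)
Definition tent (c w u : R) : R :=
  (`|u - (c - w)| + `|u - (c + w)|) / 2 - `|u - c|.

Lemma tent_ge0 c w u : 0 <= tent c w u.
Proof.
rewrite /tent; case: (ger0P (u - c)); case: (ger0P (u - (c - w)));
  case: (ger0P (u - (c + w))); lra.
Qed.

Lemma tent_gt c w u : w - `|u - c| <= tent c w u.
Proof.
rewrite /tent; case: (ger0P (u - c)); case: (ger0P (u - (c - w)));
  case: (ger0P (u - (c + w))); lra.
Qed.

Lemma tent_support c w u : 0 < w -> 0 < tent c w u -> `|u - c| < w.
Proof.
rewrite /tent; case: (ger0P (u - c)); case: (ger0P (u - (c - w)));
  case: (ger0P (u - (c + w))); lra.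
Qed.

Lemma tent_average_is_cvgn A pi t0 x c w : (forall t, stochastic (A t)) ->
  absolute_probability_sequence A pi -> trajectory A t0 x ->
  cvgn (fun n => \sum_i pi (t0 + n)%N i 0 * tent c w (x n i)).
Proof.
move=> hA hpi xt.
pose D d n := \sum_i pi (t0 + n)%N i 0 * `|x n i - d|.
have cD d : cvgn (D d) by exact: abs_deviation_is_cvgn hA hpi xt.
rewrite (_ : (fun n => _) =
  (fun n => 2^-1 * (D (c - w) n + D (c + w) n) - D c n)).
  apply: is_cvgB => //; apply: is_cvgM; first exact: is_cvg_cst.
  exact: is_cvgD.
apply/funext => n; rewrite /D -big_split mulr_sumr -sumrB /=.
by apply: eq_bigr => i _; rewrite /tent; ring.
Qed.

(** Among [N.+1] disjoint intervals, one ends up free of values: an interval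
    visited infinitely often carries, in the limit, positive average of its
    tent, hence ends up always occupied, and there are only [N] values. *)
Lemma eventual_gap A pi (p : R) t0 x (a b : R) : (forall t, stochastic (A t)) ->
  absolute_probability_sequence A pi -> 0 < p -> (forall t i, p <= pi t i 0) ->
  trajectory A t0 x -> a < b ->
  exists c w : R, [/\ 0 < w, a < c, c < b &
    \forall n \near \oo, forall i, w <= `|x n i - c|].
Proof.
move=> hA hpi p0 hp xt ab.
(* The centres [c k] are [h] apart, inside ]a, b[, so the open intervals of
   half-width [h / 2] around them are disjoint. *)
pose h := (b - a) / N.+2%:R.
have h0 : 0 < h by rewrite divr_gt0 ?subr_gt0 ?ltr0n.
have hN : h * N.+2%:R = b - a by rewrite divfK // pnatr_eq0.
pose c (k : 'I_N.+1) := a + h * k.+1%:R.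
pose H k n := \sum_i pi (t0 + n)%N i 0 * tent (c k) (h / 2) (x n i).
have cH k : cvgn (H k) by exact: tent_average_is_cvgn hA hpi xt.
(* An average below [p * (h / 4)] forces every single tent value, of weight at
   least [p], below [h / 4]. *)
have [[k lk]|nk] := pselect (exists k, limn (H k) < p * (h / 4)).
  exists (c k), (h / 4); split.
  - by rewrite divr_gt0 // ltr0n.
  - by rewrite ltrDl mulr_gt0 // ltr0n.
  - by rewrite /c -ltrBrDl -hN ltr_pM2l // ltr_nat ltnS ltn_ord.
  - have : \forall n \near \oo, H k n < p * (h / 4).
      exact: (cvgr_lt (limn (H k))).
    apply: filterS => n Hn i.
    have : p * tent (c k) (h / 2) (x n i) <= H k n.
      rewrite /H (bigD1 i) //= -[leLHS]addr0 lerD //.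
        by rewrite ler_wpM2r // tent_ge0.
      apply: sumr_ge0 => j _.
      by rewrite mulr_ge0 ?tent_ge0 // (abs_prob_ge0 _ _ hpi).
    move=> /le_lt_trans/(_ Hn); rewrite ltr_pM2l // => tl.
    by have := tent_gt (c k) (h / 2) (x n i); lra.
(* Otherwise all intervals are occupied at some common time. *)
have : \forall n \near \oo, forall k, 0 < H k n.
  apply: (filter_forall (F := \oo)) => k; apply: (cvgr_gt (limn (H k))) => //.
  have ph : 0 < p * (h / 4) by apply: mulr_gt0 => //; lra.
  by rewrite (lt_le_trans ph) // leNgt; apply/negP => lk; apply: nk; exists k.
move=> [n _ /(_ n (leqnn n)) Hn].
have /choice[f Hf] : forall k, exists i, `|x n i - c k| < h / 2.
  move=> k; apply: contrapT => nx; have := Hn k; apply/negP; rewrite -leNgt.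
  apply: sumr_le0 => i _; rewrite mulr_ge0_le0 ?(abs_prob_ge0 _ _ hpi) //.
  rewrite leNgt; apply/negP => t0'; apply: nx; exists i.
  by apply: tent_support t0'; lra.
suff /fintype.leq_card : injective f by rewrite !card_ord ltnn.
have ckl (k l : 'I_N.+1) : (k < l)%N -> c k + h <= c l.
  move=> kl; rewrite /c -addrA lerD2l -[X in _ + X]mulr1 -mulrDr ler_pM2l //.
  by rewrite -(natrD _ _ 1) ler_nat addn1 ltnS.
move=> k l fkl; apply/val_inj; have := Hf k; have := Hf l; rewrite fkl.
rewrite !ltr_norml => /andP[? ?] /andP[? ?].
case: (ltngtP k l) => // /ckl ?; exfalso; lra.
Qed.

(** * Jets separated by a gap in the values *)

Lemma inflow_gap A t0 x n (w : R) (S T : {set 'I_N}) :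
  (forall t, stochastic (A t)) ->
  (forall i j, i \in S -> j \in T -> w ^+ 2 <= (x n j - x n.+1 i) ^+ 2) ->
  w ^+ 2 * inflow (A (t0 + n)%N) S T <= jump A t0 x n.
Proof.
move=> hA ST; rewrite /inflow mulr_sumr; have [M0 _] := hA (t0 + n)%N.
rewrite big_mkcond; apply: ler_sum => i _; case: ifPn => [iS|_]; last first.
  by apply: sumr_ge0 => j _; rewrite mulr_ge0 ?sqr_ge0.
rewrite mulr_sumr big_mkcond; apply: ler_sum => j _; case: ifPn => [jT|_].
  by rewrite mulrC ler_wpM2l // ST.
by rewrite mulr_ge0 ?sqr_ge0.
Qed.

(** Weight passing between two jets at time [t]: the general term of
    [jet_flow_U]. *)
Definition exchange A (J K : jet N) t : R :=
  inflow (A t) (J t.+1) (K t) + inflow (A t) (K t.+1) (J t).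

Lemma exchange_ge0 A J K t : (forall t, stochastic (A t)) ->
  0 <= exchange A J K t.
Proof. by move=> hA; apply: addr_ge0; apply/inflow_ge0/stochastic_nonneg. Qed.

Lemma jet_flow_U_ltyP A J K : (forall t, stochastic (A t)) ->
  (jet_flow_U A J K < +oo)%E <-> bounded_sums (exchange A J K).
Proof. by move=> hA; apply: nneseries_ltyP => t; exact: exchange_ge0. Qed.

(** Only the tail of a jet matters for the infinite jet-flow property. *)
Lemma infinite_jet_flow_tail A (W : {set 'I_N}) (J : jet N) T :
  (forall t, stochastic (A t)) -> infinite_jet_flow A W ->
  (forall t, (T <= t)%N -> J t != finset.set0 /\ J t \proper W) ->
  ~ bounded_sums (fun n => exchange A J (jet_compl W J) (T + n)%N).
Proof.
move=> hA fW JW bJ.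
(* Freezing [J] before time [T] makes it proper at all times. *)
pose J' : jet N := fun t => J (maxn T t).
have pJ' : proper_jet W J' by move=> t; apply: JW; rewrite leq_maxl.
have : (jet_flow_U A J' (jet_compl W J') < +oo)%E.
  apply/(jet_flow_U_ltyP _ _ hA).
  apply/(bounded_sums_shift T) => [n|]; first exact: exchange_ge0.
  apply: bounded_sums_le bJ => n.
  rewrite /exchange /jet_compl /J' -addnS.
  by rewrite !(maxn_idPr _) ?leq_addr.
by rewrite fW.
Qed.

(** Once all values stay at distance [w] from the level [c], every crossing of
    this level is a jump of size at least [w], so the states of [W] above the
    level exchange finite weight with the other states of [W]. *)
Lemma gap_exchange A pi (p : R) t0 x (c w : R) (W : {set 'I_N}) T :
  (forall t, stochastic (A t)) ->
  absolute_probability_sequence A pi -> 0 < p -> (forall t i, p <= pi t i 0) ->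
  trajectory A t0 x -> 0 < w ->
  (forall n, (T <= n)%N -> forall i, w <= `|x n i - c|) ->
  let J : jet N := fun t => [set i in W | c < x (t - t0)%N i]%SET in
  bounded_sums (fun n => exchange A J (jet_compl W J) (t0 + T + n)%N).
Proof.
move=> hA hpi p0 hp xt w0 gap J.
have := bounded_jumps hA hpi p0 hp xt.
move=> /(bounded_sums_shift T (fun n => jump_ge0 t0 x n hA)) => bj.
have w2 : 0 < w ^+ 2 by rewrite exprn_gt0.
have w2i : 0 <= 2 / w ^+ 2 by rewrite divr_ge0 // ltW.
have := bounded_sumsZ w2i bj; apply: bounded_sums_le => n /=; rewrite -addnA.
set m := (T + n)%N; have Tm : (T <= m)%N by exact: leq_addr.
have e1 : J (t0 + m)%N = [set i in W | c < x m i]%SET by rewrite /J addKn.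
have e2 : J (t0 + m).+1 = [set i in W | c < x m.+1 i]%SET.
  by rewrite /J -addnS addKn.
have g1 := gap m Tm; have g2 := gap m.+1 (leqW Tm).
have sq (u v : R) : w <= `|u - c| -> w <= `|v - c| -> c < u -> v <= c ->
    w ^+ 2 <= (u - v) ^+ 2.
  move=> wu wv cu vc.
  have {}wu : w <= u - c by move: wu; rewrite ger0_norm // subr_ge0 ltW.
  have {}wv : w <= c - v by move: wv; rewrite distrC ger0_norm // subr_ge0.
  by apply: lerXn2r; rewrite ?nnegrE; lra.
rewrite mulrAC ler_pdivlMr // mulrC /exchange /jet_compl e1 e2 mulrDr.
rewrite (_ : 2 * _ = jump A t0 x m + jump A t0 x m); last by ring.
apply: lerD; apply: inflow_gap => // i j; rewrite !inE.
  move=> /andP[_ ci] /andP[/nandP[/negP //|] + jW].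
  by rewrite -leNgt => cj; rewrite -[leRHS]sqrrN opprB; exact: sq.
move=> /andP[/nandP[/negP //|]].
by rewrite -leNgt => cj jW /andP[_ ci]; exact: sq.
Qed.

End Dissipation.

(** * Islands *)

Section Islands.
Context {R : realType} {N : nat}.
Implicit Types (A : nat -> 'M[R]_N) (W : {set 'I_N}).

Lemma infinite_flow_edge_sym A : symmetric (infinite_flow_edge A).
Proof.
move=> i j; rewrite /infinite_flow_edge eq_sym.
by under eq_eseriesr => t _ do rewrite addrC.
Qed.

Lemma connect_edge_sym A : connect_sym (infinite_flow_edge A).
Proof. exact: sym_connect_sym (infinite_flow_edge_sym A). Qed.

(** The island containing the state [i]. *)
Definition island_of A i : {set 'I_N} :=
  [set j in [set: 'I_N]%SET | connect (infinite_flow_edge A) i j]%SET.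

Lemma mem_island_of A i j :
  (j \in island_of A i) = connect (infinite_flow_edge A) i j.
Proof. by rewrite !inE. Qed.

Lemma island_of_in A i : island_of A i \in islands A.
Proof. by apply: imset_f; rewrite finset.in_setT. Qed.

Lemma island_eq A W i : W \in islands A -> i \in W -> W = island_of A i.
Proof.
move=> /imsetP[k _ ->]; rewrite -/(island_of A k) mem_island_of => ki.
apply/finset.setP => j; rewrite !mem_island_of.
exact: (same_connect (connect_edge_sym A) ki).
Qed.

Lemma island_mem A W : W \in islands A -> exists i, i \in W.
Proof.
by move=> /imsetP[k _ ->]; exists k; rewrite -/(island_of A k) mem_island_of.
Qed.

Lemma island_connect A W i j : W \in islands A -> i \in W ->
  (j \in W) = connect (infinite_flow_edge A) i j.
Proof. by move=> WA /(island_eq WA) ->; rewrite mem_island_of. Qed.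

Lemma no_edge_bounded A i j : (forall t, stochastic (A t)) ->
  i != j -> ~~ infinite_flow_edge A i j ->
  bounded_sums (fun t => A t i j + A t j i).
Proof.
move=> hA ij; rewrite /infinite_flow_edge ij /= => noo.
apply/nneseries_ltyP; last by rewrite ltey.
by move=> t; case: (hA t) => M0 _; rewrite addr_ge0.
Qed.

(** Islands exchange only finite total weight with the rest. *)
Lemma island_inflow A W : (forall t, stochastic (A t)) -> W \in islands A ->
  bounded_sums (fun t => inflow (A t) W (~: W)) /\
  bounded_sums (fun t => inflow (A t) (~: W) W).
Proof.
move=> hA WA.
have b i j : i \in W -> j \in ~: W -> bounded_sums (fun t => A t i j + A t j i).
  move=> iW; rewrite finset.in_setC => jW; apply: no_edge_bounded => //.
    by apply: contraNneq jW => <-.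
  by apply: contra jW => /connect1; rewrite (island_connect _ WA iW).
split; apply: bounded_sums_sum => i iW; apply: bounded_sums_sum => j jW.
  apply: bounded_sums_le (b i j iW jW) => t.
  by rewrite lerDl; case: (hA t).
apply: bounded_sums_le (b j i jW iW) => t.
by rewrite lerDr; case: (hA t).
Qed.

Lemma leak_island A W : (forall t, stochastic (A t)) -> W \in islands A ->
  bounded_sums (leak A (fun=> W)) /\ bounded_sums (leak A (fun=> ~: W)).
Proof. by move=> hA /(island_inflow hA); rewrite /leak finset.setCK. Qed.

(** Inside an island, finite exchange between a jet and its complement leaves
    finite leaks into both. *)
Lemma leak_jet A W (J : jet N) : (forall t, stochastic (A t)) ->
  W \in islands A -> (forall t, J t \subset W) ->
  bounded_sums (exchange A J (jet_compl W J)) ->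
  bounded_sums (leak A J) /\ bounded_sums (leak A (jet_compl W J)).
Proof.
move=> hA WA JW bJ; have [bW _] := island_inflow hA WA.
have A0 t := stochastic_nonneg (hA t).
split; apply: bounded_sums_le (bounded_sumsD bJ bW) => t;
    rewrite /leak /exchange /jet_compl.
  apply: (@le_trans _ _ (inflow (A t) (J t.+1) ((W :\: J t) :|: ~: W))).
    apply: inflow_mono => //; apply/fintype.subsetP => i; rewrite !inE.
    by case: (i \in W); case: (i \in J t).
  apply: le_trans (inflow_setUr _ _ _ (A0 t)) _; apply: lerD.
    by rewrite lerDl inflow_ge0.
  by apply: inflow_mono => //.
apply: (@le_trans _ _ (inflow (A t) (W :\: J t.+1) (J t :|: ~: W))).
  apply: inflow_mono => //; apply/fintype.subsetP => i; rewrite !inE.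
  by case: (i \in W); case: (i \in J t).
apply: le_trans (inflow_setUr _ _ _ (A0 t)) _; apply: lerD.
  by rewrite lerDr inflow_ge0.
by apply: inflow_mono => //; exact: finset.subsetDl.
Qed.

End Islands.

(** * Class-ergodic chains: islands are the ergodic classes *)

Section Ergodic.
Context {R : realType} {N : nat}.
Implicit Types (A : nat -> 'M[R]_N) (W S : {set 'I_N}).

Lemma prod_weight1 A t0 j n i :
  prod_weight A t0 [set j]%SET n i = backward_prod A t0 n i j.
Proof. by rewrite /prod_weight finset.big_set1. Qed.

Lemma class_ergodicP A : class_ergodic A <->
  forall t0 i j, cvgn (fun n => backward_prod A t0 n i j).
Proof.
split=> [eA t0 i j|cA t0].
  have /cvg_mxP/(_ i j) := eA t0; exact: cvgP.
apply/cvg_ex; exists (\matrix_(i, j) limn (fun n => backward_prod A t0 n i j)).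
by apply/cvg_mxP => i j; rewrite mxE; exact: cA.
Qed.

Lemma same_ergodic_classP A i j : same_ergodic_class A i j <->
  forall t0 k, (fun n => backward_prod A t0 n i k - backward_prod A t0 n j k)
    @ \oo --> (0 : R).
Proof.
split=> [h t0 k|h t0].
  have /cvg_mxP/(_ 0 k) := h t0; rewrite mxE.
  by under eq_fun do rewrite !mxE.
apply/cvg_mxP => z k; rewrite mxE; under eq_fun do rewrite !mxE.
exact: h.
Qed.

Lemma same_ergodic_class_weight A i j t0 S : same_ergodic_class A i j ->
  (fun n => prod_weight A t0 S n i - prod_weight A t0 S n j) @ \oo --> (0 : R).
Proof.
move=> /same_ergodic_classP h.
under eq_fun => n do rewrite /prod_weight -sumrB.
suff : (fun n => \sum_(k in S)
    (backward_prod A t0 n i k - backward_prod A t0 n j k)) @ \oo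
    --> \sum_(k in S) (0 : R) by rewrite big1.
by apply: cvg_big => [|k _]; [exact: add_continuous|exact: h].
Qed.

Lemma same_ergodic_class_refl A i : same_ergodic_class A i i.
Proof.
apply/same_ergodic_classP => t0 k; under eq_fun do rewrite subrr.
exact: cvg_cst.
Qed.

Lemma same_ergodic_class_trans A i j k : same_ergodic_class A i j ->
  same_ergodic_class A j k -> same_ergodic_class A i k.
Proof.
move=> /same_ergodic_classP ij /same_ergodic_classP jk.
apply/same_ergodic_classP => t0 l.
rewrite (_ : (fun n => _) = fun n =>
  (backward_prod A t0 n i l - backward_prod A t0 n j l) +
  (backward_prod A t0 n j l - backward_prod A t0 n k l)).
  by rewrite -(addr0 0); exact: cvgD.
by apply/funext => n /=; rewrite addrA subrK.
Qed.

(** Distinct limits at the ends of an edge would make the infinite flow along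
    it contradict the summability of the squared jumps. *)
Lemma edge_same_ergodic_class A i j : (forall t, stochastic (A t)) ->
  class_Pstar A -> class_ergodic A -> infinite_flow_edge A i j ->
  same_ergodic_class A i j.
Proof.
move=> hA [pi hpi [p p0 hp]] /class_ergodicP eA /andP[ij /eqP foo].
apply/same_ergodic_classP => t0 k.
pose x := prod_weight A t0 [set k]%SET.
have xt : trajectory A t0 x by exact: prod_weight_trajectory.
pose al l := limn (fun n => backward_prod A t0 n l k).
have cx l : (fun n => x n l) @ \oo --> al l.
  by rewrite /x; under eq_fun => n do rewrite prod_weight1; exact: eA.
have [alE|alN] := eqVneq (al i) (al j).
  rewrite -[0](subrr (al i)) [in X in _ --> _ - X]alE.
  under eq_fun => n do rewrite -!prod_weight1.
  by apply: cvgB; exact: cx.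
(* Late values are within [d] of their limits, so jumps along the edge in
   either direction are of size at least [d]. *)
exfalso; pose d := `|al i - al j| / 3.
have d0 : 0 < d by rewrite divr_gt0 ?normr_gt0 ?subr_eq0.
have d3 : `|al i - al j| = 3 * d by rewrite /d; field.
have close l : \forall n \near \oo, `|al l - x n l| < d.
  exact: (cvgr_dist_lt _ _ (cx l) _ d0).
have [T _ HT] : \forall n \near \oo, `|al i - x n i| < d /\ `|al j - x n j| < d.
  by near do split.
have far n m : (T <= n)%N -> (T <= m)%N -> d ^+ 2 <= (x n j - x m i) ^+ 2
    /\ d ^+ 2 <= (x n i - x m j) ^+ 2.
  move=> Tn Tm; have [xi xj] := HT n Tn; have [yi yj] := HT m Tm.
  have dd (u v : R) : `|al i - u| < d -> `|al j - v| < d ->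
      d ^+ 2 <= (u - v) ^+ 2.
    move=> ud vd; rewrite -[leRHS]real_normK ?num_real //.
    rewrite lerXn2r ?nnegrE ?(ltW d0) //.
    have : `|al i - al j| <= `|al i - u| + `|u - v| + `|al j - v|.
      rewrite (_ : al i - al j = (al i - u) + (u - v) + (v - al j)); last ring.
      rewrite [X in _ <= _ + X]distrC.
      by rewrite !(le_trans (ler_normD _ _)) ?lerD2r ?ler_normD.
    by rewrite d3; lra.
  by split; [rewrite -[leRHS]sqrrN opprB|]; exact: dd.
have bj := bounded_jumps hA hpi p0 hp xt.
have A0 t : 0 <= A t i j + A t j i by case: (hA t) => M0 _; rewrite addr_ge0.
have d2 : 0 < d ^+ 2 by rewrite exprn_gt0.
have : (\sum_(0 <= t <oo) (A t i j + A t j i)%:E < +oo)%E.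
  apply/nneseries_ltyP => //; apply/(bounded_sums_shift t0) => //.
  have b0 : 0 <= 2 / d ^+ 2 by rewrite divr_ge0 // ltW.
  apply: (bounded_sums_near (T := T) _ _ _ (bounded_sumsZ b0 bj)) => n //=.
    by rewrite mulr_ge0 // jump_ge0.
  move=> Tn; rewrite mulrAC ler_pdivlMr // mulrC mulrDr.
  rewrite (_ : 2 * _ = jump A t0 x n + jump A t0 x n); last by ring.
  have sing k1 k2 : A (t0 + n)%N k1 k2 =
      inflow (A (t0 + n)%N) [set k1]%SET [set k2]%SET.
    by rewrite /inflow !finset.big_set1.
  have [f1 f2] := far n n.+1 Tn (leqW Tn).
  by apply: lerD; rewrite sing; apply: inflow_gap => // k1 k2;
    rewrite !inE => /eqP -> /eqP ->.
by rewrite foo.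
Unshelve. all: by end_near.
Qed.

Lemma connect_same_ergodic_class A i j : (forall t, stochastic (A t)) ->
  class_Pstar A -> class_ergodic A -> connect (infinite_flow_edge A) i j ->
  same_ergodic_class A i j.
Proof.
move=> hA hP eA /connectP[s + ->]; elim: s i => [|k s IHs] i /=.
  by move=> _; exact: same_ergodic_class_refl.
move=> /andP[ik /IHs]; apply: same_ergodic_class_trans.
exact: edge_same_ergodic_class.
Qed.

(** The indicator of an island stays almost an indicator if started late. *)
Lemma island_separation A W (e : R) : (forall t, stochastic (A t)) ->
  W \in islands A -> 0 < e -> exists t0, forall n,
    (forall i, i \in W -> 1 - e <= prod_weight A t0 W n i) /\
    (forall i, i \notin W -> prod_weight A t0 W n i <= e).
Proof.
move=> hA WA e0; have [b1 b2] := leak_island hA WA.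
have [T HT] := jet_separation hA e0 (fun t => subxx (~: W)) b1 b2.
exists T => n; have [h1 h2] := HT T (leqnn T) n; split=> // i iW.
by apply: h2; rewrite finset.in_setC.
Qed.

Lemma same_ergodic_class_connect A i j : (forall t, stochastic (A t)) ->
  same_ergodic_class A i j -> connect (infinite_flow_edge A) i j.
Proof.
move=> hA ij; rewrite -mem_island_of; apply: contraT => jW.
have e0 : 0 < 4^-1 :> R by rewrite invr_gt0 ltr0n.
have [t0 H] := island_separation hA (island_of_in A i) e0.
have [n _ /(_ n (leqnn n))] :=
  cvgr_dist_lt _ _ (same_ergodic_class_weight t0 (island_of A i) ij) _ e0.
have [/(_ i) h1 /(_ j jW) h2] := H n.
rewrite /= sub0r normrN ltr_norml => /andP[_].
have : 1 - 4^-1 <= prod_weight A t0 (island_of A i) n i.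
  by apply: h1; rewrite mem_island_of.
lra.
Qed.

Lemma islands_ergodic_classes A : (forall t, stochastic (A t)) ->
  class_Pstar A -> class_ergodic A -> islands A = ergodic_classes A.
Proof.
move=> hA hP eA; rewrite /islands /ergodic_classes; congr equivalence_partition.
apply/funext => i; apply/funext => j; apply/idP/asboolP.
  exact: connect_same_ergodic_class.
exact: same_ergodic_class_connect.
Qed.

Lemma ergodic_infinite_jet_flow A W : (forall t, stochastic (A t)) ->
  class_Pstar A -> class_ergodic A -> W \in islands A ->
  infinite_jet_flow A W.
Proof.
move=> hA hP eA WA J pJ; apply: contrapT => /eqP; rewrite -ltey.
move=> /(jet_flow_U_ltyP _ _ hA) bJ.
have JW t : J t \subset W by have [_ /proper_sub] := pJ t.
have [b1 b2] := leak_jet hA WA JW bJ.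
have e0 : 0 < 4^-1 :> R by rewrite invr_gt0 ltr0n.
have KJ t : jet_compl W J t \subset ~: J t.
  by apply/fintype.subsetP => i; rewrite !inE => /andP[].
have [t0 /(_ t0 (leqnn t0)) H] := jet_separation hA e0 KJ b1 b2.
have : \forall n \near \oo, forall i j, i \in W -> j \in W ->
    `|0 - (prod_weight A t0 (J t0) n i - prod_weight A t0 (J t0) n j)| < 4^-1.
  apply: (filter_forall (F := \oo)) => i.
  apply: (filter_forall (F := \oo)) => j.
  have [iW|iW] := boolP (i \in W); last by apply: nearW.
  have [jW|jW] := boolP (j \in W); last by apply: nearW.
  have ij : same_ergodic_class A i j.
    apply: connect_same_ergodic_class => //.
    by rewrite -(island_connect _ WA iW).
  have cij := same_ergodic_class_weight t0 (J t0) ij.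
  by apply: filterS (cvgr_dist_lt _ _ cij _ e0) => n Hn _ _.
move=> [n _ /(_ n (leqnn n)) Hn].
have [J0 /properP[_ [j jW jJ]]] := pJ (t0 + n)%N.
have /set0Pn[i iJ] := J0; have iW := fintype.subsetP (JW _) i iJ.
have [/(_ i iJ) h1 /(_ j) h2] := H n.
have {}h2 : prod_weight A t0 (J t0) n j <= 4^-1.
  by apply: h2; rewrite /jet_compl finset.in_setD jJ.
by have := Hn i j iW jW; rewrite sub0r normrN ltr_norml => /andP[_]; lra.
Qed.

End Ergodic.

(** * Infinite jet-flow over the islands forces convergence *)

Section Convergence.
Context {R : realType} {N : nat}.
Implicit Types (A : nat -> 'M[R]_N) (W S : {set 'I_N}).

(** Least value over [W] of the solution started from the indicator of [S]; the
    default value 1 bounds all values. The greatest value over [W] is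
    [1 - island_min A t0 (~: S) W n]. *)
Definition island_min A t0 S W n : R :=
  \big[Num.min/1]_(i in W) prod_weight A t0 S n i.

Lemma island_min_ge0 A t0 S W n : (forall t, stochastic (A t)) ->
  0 <= island_min A t0 S W n.
Proof. by move=> hA; apply: le_bigmin => // i _; exact: prod_weight_ge0. Qed.

Lemma island_min_le1 A t0 S W n : island_min A t0 S W n <= 1.
Proof. exact: bigmin_le_id. Qed.

Lemma island_min_le A t0 S W n i : i \in W ->
  island_min A t0 S W n <= prod_weight A t0 S n i.
Proof. by move=> iW; exact: bigmin_le_cond. Qed.

Lemma le_island_min A t0 S W n (a : R) : a <= 1 ->
  (forall i, i \in W -> a <= prod_weight A t0 S n i) ->
  a <= island_min A t0 S W n.
Proof. by move=> a1 aW; exact: le_bigmin. Qed.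

Lemma island_min_is_cvgn A t0 S W : (forall t, stochastic (A t)) ->
  W \in islands A -> cvgn (island_min A t0 S W).
Proof.
move=> hA /(island_inflow hA)[bW _].
have A0 t := stochastic_nonneg (hA t).
have i0 t : 0 <= inflow (A t) W (~: W) by exact: inflow_ge0.
suff cN : cvgn (fun n => - island_min A t0 S W n).
  by rewrite -is_cvgNE; exact: cN.
apply: (@quasi_nonincreasing_is_cvgn _ _
    (fun n => inflow (A (t0 + n)%N) W (~: W)) (-1)) => // [|n|n].
- exact/(bounded_sums_shift t0 i0).
- by rewrite lerN2 island_min_le1.
suff : island_min A t0 S W n - inflow (A (t0 + n)%N) W (~: W)
    <= island_min A t0 S W n.+1 by rewrite /=; lra.
have m1 := island_min_le1 A t0 S W n.
apply: le_island_min => [|i iW]; first by have := i0 (t0 + n)%N; lra.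
rewrite prod_weight_trajectory.
apply: le_trans (step_lower i (hA _) (fun j => prod_weight_ge0 t0 S n j hA) m1
  (fun j => @island_min_le A t0 S W n j)).
rewrite lerD2l lerN2 /inflow [leRHS](bigD1 i) //= lerDl.
by apply: sumr_ge0 => k _; apply: sumr_ge0 => j _; exact: A0.
Qed.

(** If the extreme values over an island had distinct limits, a level between
    them would eventually be avoided by all values, and the states above it
    would form a proper jet exchanging finite flow with its complement. *)
Lemma island_limits_eq A t0 S W : (forall t, stochastic (A t)) ->
  class_Pstar A -> W \in islands A -> infinite_jet_flow A W ->
  limn (fun n => 1 - island_min A t0 (~: S) W n) <= limn (island_min A t0 S W).
Proof.
move=> hA [pi hpi [p p0 hp]] WA fW; rewrite leNgt; apply/negP => ab.
pose x := prod_weight A t0 S.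
have xt : trajectory A t0 x by exact: prod_weight_trajectory.
have clo := island_min_is_cvgn (t0 := t0) (S := S) hA WA.
have chi : cvgn (fun n => 1 - island_min A t0 (~: S) W n).
  by apply: is_cvgB; [exact: is_cvg_cst|exact: island_min_is_cvgn].
have [c [w [w0 ac cb gap]]] := eventual_gap hA hpi p0 hp xt ab.
have c0 : 0 <= c.
  apply: le_trans (ltW ac); apply: limr_ge => //; apply: nearW => n.
  exact: island_min_ge0.
have c1 : c <= 1.
  apply: le_trans (ltW cb) _; apply: limr_le => //; apply: nearW => n.
  by rewrite gerBl; exact: island_min_ge0.
have [T _ HT] : \forall n \near \oo, (island_min A t0 S W n < c /\
    c < 1 - island_min A t0 (~: S) W n) /\ forall i, w <= `|x n i - c|.
  near=> n; split; [split|]; near: n => //.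
    exact: (cvgr_lt (limn (island_min A t0 S W))).
  exact: (cvgr_gt (limn (fun n => 1 - island_min A t0 (~: S) W n))).
have gapT n : (T <= n)%N -> forall i, w <= `|x n i - c| by move=> /HT[].
apply: (infinite_jet_flow_tail hA fW _
  (gap_exchange W hA hpi p0 hp xt w0 gapT)).
move=> t Tt; have [n -> Tn] : exists2 n, t = (t0 + n)%N & (T <= n)%N.
  exists (t - t0)%N; first by rewrite subnKC // (leq_trans _ Tt) ?leq_addr.
  by rewrite leq_subRL // (leq_trans _ Tt) ?leq_addr.
rewrite addKn; have [[lo hi] _] := HT n Tn; split.
  apply: contraTN hi => /eqP J0; rewrite -leNgt lerBlDl -lerBlDr.
  apply: le_island_min => [|i iW]; first by rewrite gerBl.
  rewrite prod_weightC // lerD2l lerN2 leNgt; apply/negP => ci.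
  by have := finset.in_set0 i; rewrite -J0 inE iW ci.
rewrite properE; apply/andP; split.
  by apply/fintype.subsetP => i; rewrite inE => /andP[].
apply: contraTN lo => /fintype.subsetP WJ; rewrite -leNgt.
by apply: le_island_min => // i /WJ; rewrite inE => /andP[_ /ltW].
Unshelve. all: by end_near.
Qed.

Lemma infinite_jet_flow_ergodic A : (forall t, stochastic (A t)) ->
  class_Pstar A -> (forall W, W \in islands A -> infinite_jet_flow A W) ->
  class_ergodic A.
Proof.
move=> hA hP fA; apply/class_ergodicP => t0 i k.
have WA := island_of_in A i; set W := island_of A i in WA.
have iW : i \in W by rewrite mem_island_of.
pose S := [set k]%SET.
have clo := island_min_is_cvgn (t0 := t0) (S := S) hA WA.
have chi : cvgn (fun n => 1 - island_min A t0 (~: S) W n).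
  by apply: is_cvgB; [exact: is_cvg_cst|exact: island_min_is_cvgn].
have lohi n : island_min A t0 S W n <= prod_weight A t0 S n i <=
    1 - island_min A t0 (~: S) W n.
  rewrite island_min_le //=.
  have := island_min_le A t0 (~: S) n iW; rewrite prod_weightC //; lra.
have lim_eq : limn (fun n => 1 - island_min A t0 (~: S) W n) =
    limn (island_min A t0 S W).
  apply/eqP; rewrite eq_le (island_limits_eq _ _ hA hP WA (fA W WA)) /=.
  apply: ler_lim => //; apply: nearW => n.
  by have /andP[h1 h2] := lohi n; exact: le_trans h1 h2.
apply: (@cvgP _ _ (limn (island_min A t0 S W))).
under eq_fun => n do rewrite -prod_weight1.
apply: (squeeze_cvgr _ clo); first by apply: nearW => n; exact: lohi.
by rewrite -lim_eq.
Qed.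

End Convergence.

(** * The jet decomposition of a class-ergodic chain *)

Section Decomposition.
Context {R : realType} {N : nat}.
Implicit Types (A : nat -> 'M[R]_N) (pi : nat -> 'cV[R]_N) (W S : {set 'I_N}).

(** At each step the pi-mass of an island increases by at most the weight that
    enters it, and these weights are summable. *)
Lemma island_mass_cvg A pi (p : R) W : (forall t, stochastic (A t)) ->
  absolute_probability_sequence A pi -> 0 < p -> (forall t i, p <= pi t i 0) ->
  W \in islands A ->
  exists2 m : R, 0 < m & (fun t => \sum_(i in W) pi t i 0) @ \oo --> m.
Proof.
move=> hA hpi p0 hp WA; have [bW _] := island_inflow hA WA.
have A0 t := stochastic_nonneg (hA t).
pose u t := \sum_(i in W) pi t i 0.
have up t : p <= u t.
  have [i iW] := island_mem WA; rewrite /u (bigD1 i) //= -[p]addr0 lerD //.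
  by apply: sumr_ge0 => j _; exact: (abs_prob_ge0 _ _ hpi).
have uS t : u t.+1 <= u t + inflow (A t) W (~: W).
  have -> : u t = \sum_j pi t j 0 * (j \in W)%:R.
    by rewrite /u big_mkcond; apply: eq_bigr => j _; rewrite mulr_natr mulrb.
  (* Only the rows in [W] matter for this bound; the others contribute
     nonnegatively to the mass of [W] at time [t]. *)
  rewrite (absolute_probability_avg _ _ hpi) /u -lerBlDr -sumrB.
  rewrite [leRHS](bigID (mem W)) /= -[leLHS]addr0; apply: lerD; last first.
    apply: sumr_ge0 => i _; apply: mulr_ge0.
      exact: (abs_prob_ge0 _ _ hpi).
    by apply: sumr_ge0 => j _; rewrite mulr_ge0 ?ler0n //; exact: A0.
  apply: ler_sum => i iW.
  under [in leRHS]eq_bigr => j _ do rewrite mulr_natr mulrb.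
  rewrite -big_mkcond /=.
  have s1 : \sum_(j in W) A t i j + \sum_(j in ~: W) A t i j = 1.
    rewrite -(proj2 (hA t) i) [RHS](bigID (mem W)) /=; congr (_ + _).
    by apply: eq_bigl => j; rewrite finset.in_setC.
  have s0 : 0 <= \sum_(j in ~: W) A t i j by apply: sumr_ge0 => j _; exact: A0.
  have := abs_prob_le1 t.+1 i hpi; have := abs_prob_ge0 t.+1 i hpi.
  by nra.
have cu : cvgn u.
  apply: (@quasi_nonincreasing_is_cvgn _ u
    (fun t => inflow (A t) W (~: W)) p) => //.
  by move=> t; exact: inflow_ge0.
exists (limn u) => //; apply: lt_le_trans p0 _.
by apply: limr_ge => //; apply: nearW.
Qed.

Lemma cvg_selection W (x : nat -> 'I_N -> R) (l : R) (s : nat -> 'I_N) :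
  (forall i, i \in W -> (fun t => x t i) @ \oo --> l) ->
  (forall t, s t \in W) -> (fun t => x t (s t)) @ \oo --> l.
Proof.
move=> xl sW; apply/cvgrPdist_lt => e e0.
have : \forall t \near \oo, forall i, i \in W -> `|l - x t i| < e.
  apply: (filter_forall (F := \oo)) => i.
  have [iW|iW] := boolP (i \in W); last by apply: nearW.
  by apply: filterS (cvgr_dist_lt _ _ (xl i iW) _ e0) => t ? _.
by apply: filterS => t; apply.
Qed.

Lemma island_solution_cvg A W tau (x : nat -> 'cV[R]_N) :
  (forall t, stochastic (A t)) -> class_Pstar A -> class_ergodic A ->
  W \in islands A -> solution_from A tau x ->
  exists xk : R, forall i, i \in W -> (fun t => x t i 0) @ \oo --> xk.
Proof.
move=> hA hP /[dup] eA /class_ergodicP cA WA xs; have [i0 i0W] := island_mem WA.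
pose l j := limn (fun n => backward_prod A tau n i0 j).
exists (\sum_j l j * x tau j 0) => i iW.
have cl j : (fun n => backward_prod A tau n i j) @ \oo --> l j.
  have /same_ergodic_classP/(_ tau j) ii0 : same_ergodic_class A i i0.
    by apply: connect_same_ergodic_class; rewrite // -(island_connect _ WA iW).
  rewrite (_ : (fun n => _) = fun n =>
      (backward_prod A tau n i j - backward_prod A tau n i0 j) +
      backward_prod A tau n i0 j).
    by rewrite -[l j]add0r; apply: cvgD => //; exact: cA.
  by apply/funext => n; rewrite subrK.
rewrite -(cvg_shiftn tau).
rewrite (_ : (fun n => _) =
    fun n => \sum_j backward_prod A tau n i j * x tau j 0).
  apply: cvg_big => [|j _]; first exact: add_continuous.
  by apply: cvgM => //; exact: cvg_cst.
by apply/funext => n /=; rewrite addnC (solution_prod _ xs) mxE.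
Qed.

Lemma islands_partition A :
  finset.partition (islands A) [set: 'I_N]%SET.
Proof.
apply: equivalence_partitionP => i j k _ _ _; split; first exact: connect0.
by move=> ij; exact: (same_connect (connect_edge_sym A) ij).
Qed.

Lemma islands_jet_decomposition A pi (p : R) : (forall t, stochastic (A t)) ->
  class_ergodic A -> absolute_probability_sequence A pi -> 0 < p ->
  (forall t i, p <= pi t i 0) ->
  jet_decomposition A pi (fun (k : 'I_#|islands A|) (_ : nat) => enum_val k).
Proof.
move=> hA eA hpi p0 hp.
have hP : class_Pstar A by exists pi => //; exists p.
have A0 t := stochastic_nonneg (hA t).
have WA (k : 'I_#|islands A|) := enum_valP k.
have EI : [set enum_val k | k : 'I_#|islands A|]%SET = islands A.
  apply/finset.setP => W; apply/imsetP/idP => [[k _ ->]//|WI].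
  by exists (enum_rank_in WI W); rewrite ?enum_rankK_in.
split.
- apply/andP; split; last first.
    by rewrite (leq_trans (leq_imset_card _ _)) // cardsT card_ord.
  have [_ s1] := proj1 hpi 0%N.
  have [i _] : exists i : 'I_N, true.
    apply: contrapT => ni; move/eqP: s1; rewrite big1 => [|i _].
      by rewrite eq_sym oner_eq0.
    by case: ni; exists i.
  by apply/card_gt0P; exists (island_of A i); exact: island_of_in.
- by move=> t; split; [exact: enum_val_inj|rewrite EI islands_partition].
- move=> k; split; first exact: island_mass_cvg hA hpi p0 hp (WA k).
  move=> tau x xs; have [xk Hxk] := island_solution_cvg hA hP eA (WA k) xs.
  by exists xk => s sW; exact: (cvg_selection Hxk sW).
move=> k s ks; have kNs : enum_val s \subset ~: enum_val k.
  apply/fintype.subsetP => i iS; rewrite finset.in_setC; apply/negP => ik.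
  move/eqP: ks; apply; apply: enum_val_inj.
  by rewrite (island_eq (WA k) ik) (island_eq (WA s) iS).
have [b1 b2] := island_inflow hA (WA k).
have r0 t i j : 0 <= flow_r A pi t i j.
  by apply: mulr_ge0; [exact: (abs_prob_ge0 _ _ hpi)|exact: A0].
have rA t i j : flow_r A pi t i j <= A t j i.
  rewrite -[leRHS]mul1r ler_wpM2r //; first exact: A0.
  exact: (abs_prob_le1 _ _ hpi).
apply/nneseries_ltyP => [t|].
  by apply: addr_ge0; apply: sumr_ge0 => i _; apply: sumr_ge0 => j _; exact: r0.
apply: bounded_sums_le (bounded_sumsD b1 b2) => t; apply: lerD.
  rewrite exchange_big /=.
  apply: (@le_trans _ _ (inflow (A t) (enum_val k) (enum_val s))).
    by apply: ler_sum => i _; apply: ler_sum => j _; exact: rA.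
  by apply: inflow_mono.
rewrite exchange_big /=.
apply: (@le_trans _ _ (inflow (A t) (enum_val s) (enum_val k))).
  by apply: ler_sum => i _; apply: ler_sum => j _; exact: rA.
by apply: inflow_mono.
Qed.

Section JetPartition.
Context (c : nat) (J : 'I_c -> jet N) (hJ : jet_partition J).

Lemma jet_partition_neq0 k t : exists i, i \in J k t.
Proof.
have [_ /and3P[_ _ J0]] := hJ t; apply/set0Pn; apply: contraNneq J0 => <-.
exact: imset_f.
Qed.

Lemma jet_partition_cover t i : exists k, i \in J k t.
Proof.
have [_ /and3P[/eqP cJ _ _]] := hJ t; have := finset.in_setT i.
by rewrite -cJ => /bigcupP[_ /imsetP[k _ ->] ik]; exists k.
Qed.

Lemma jet_partition_disjoint k s t i : i \in J k t -> i \in J s t -> k = s.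
Proof.
have [Ji /and3P[_ tJ _]] := hJ t => ik si; apply: Ji; apply/eqP.
apply: contraT => ks.
have Jk l : J l t \in [set J l t | l : 'I_c]%SET by exact: imset_f.
have /finset.trivIsetP/(_ _ _ (Jk k) (Jk s) ks) := tJ.
by move=> /pred0P/(_ i) /=; rewrite ik si.
Qed.

End JetPartition.

(** The indicator of an island separates it from the other states for good,
    while values along a jet have a common limit: a jet is eventually on one
    side of every island. *)
Lemma jet_side A pi (c : nat) (J : 'I_c -> jet N) k W :
  (forall t, stochastic (A t)) -> jet_decomposition A pi J -> W \in islands A ->
  (\forall t \near \oo, J k t \subset W) \/
  (\forall t \near \oo, J k t \subset ~: W).
Proof.
move=> hA [_ hJ /(_ k)[_ hx] _] WA.
have e0 : 0 < 4^-1 :> R by rewrite invr_gt0 ltr0n.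
have [t0 sep] := island_separation hA WA e0.
pose x t : 'cV[R]_N := \col_i prod_weight A t0 W (t - t0)%N i.
have xs : solution_from A t0 x.
  move=> t tt0; apply/matrixP => i j; rewrite !mxE subSn //.
  rewrite prod_weight_trajectory subnKC //.
  by apply: eq_bigr => l _; rewrite mxE.
have [xk Hxk] := hx t0 x xs.
(* A selection leaving [S] whenever the jet does. *)
have sel S : exists s : nat -> 'I_N, (forall t, s t \in J k t) /\
    forall t, s t \in S -> J k t \subset S.
  have /choice[s Hs] : forall t, exists i,
      i \in J k t /\ (i \in S -> J k t \subset S).
    move=> t; have [JS|/fintype.subsetPn[i iJ iS]] := boolP (J k t \subset S).
      by have [i iJ] := jet_partition_neq0 hJ k t; exists i.
    by exists i; split=> // iS'; rewrite iS' in iS.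
  by exists s; split=> t; have [] := Hs t.
have [xk2|xk2] := ltrP 2^-1 xk.
  left; have [s [sJ sW]] := sel W.
  apply: filterS (cvgr_gt xk (Hxk s sJ) _ xk2) => t; rewrite mxE => xt.
  apply: sW; apply: contraT => /(proj2 (sep (t - t0)%N)); lra.
right; have [s [sJ sW]] := sel (~: W).
have xk3 : xk < 3 / 4 by lra.
apply: filterS (cvgr_lt xk (Hxk s sJ) _ xk3) => t; rewrite mxE => xt.
apply: sW; rewrite finset.in_setC; apply/negP => /(proj1 (sep (t - t0)%N)); lra.
Qed.

Lemma jet_in_island A pi (c : nat) (J : 'I_c -> jet N) k :
  (forall t, stochastic (A t)) -> jet_decomposition A pi J ->
  exists W, W \in islands A /\ \forall t \near \oo, J k t \subset W.
Proof.
move=> hA dJ; apply: contrapT => nW; have [_ hJ _ _] := dJ.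
have : \forall t \near \oo, forall W, W \in islands A -> J k t \subset ~: W.
  apply: (filter_forall (F := \oo)) => W.
  have [WA|WA] := boolP (W \in islands A); last by apply: nearW.
  have [JW|JW] := jet_side k hA dJ WA; first by case: nW; exists W.
  by apply: filterS JW => t ? _.
move=> [t _ /(_ t (leqnn t)) Ht].
have [i iJ] := jet_partition_neq0 hJ k t.
have /fintype.subsetP/(_ i iJ) := Ht _ (island_of_in A i).
by rewrite finset.in_setC mem_island_of connect0.
Qed.

(** As pi is at least [p], the finite pi-weighted flow [jet_flow_V] bounds the
    unweighted one up to the factor 1/[p]. *)
Lemma jet_decomposition_exchange A pi (p : R) (c : nat) (J : 'I_c -> jet N)
    k s :
  (forall t, stochastic (A t)) -> absolute_probability_sequence A pi -> 0 < p ->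
  (forall t i, p <= pi t i 0) -> jet_decomposition A pi J -> k != s ->
  bounded_sums (exchange A (J k) (J s)).
Proof.
move=> hA hpi p0 hp [_ _ _ hV] /hV.
have r0 t i j : 0 <= flow_r A pi t i j.
  by apply: mulr_ge0; [exact: (abs_prob_ge0 _ _ hpi)|exact: stochastic_nonneg].
have rA t i j : p * A t j i <= flow_r A pi t i j.
  by apply: ler_wpM2r => //; exact: (stochastic_nonneg (hA t)).
have v0 t : 0 <= \sum_(i in J s t) \sum_(j in J k t.+1) flow_r A pi t i j +
    \sum_(i in J k t) \sum_(j in J s t.+1) flow_r A pi t i j.
  by apply: addr_ge0; apply: sumr_ge0 => i _; apply: sumr_ge0.
have pi0 : 0 <= p^-1 by rewrite invr_ge0 ltW.
move=> /(nneseries_ltyP v0)/(bounded_sumsZ pi0); apply: bounded_sums_le => t.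
rewrite mulrC ler_pdivlMr // mulrC mulrDr /exchange /inflow.
by apply: lerD; rewrite [leRHS]exchange_big mulr_sumr;
  apply: ler_sum => i _; rewrite mulr_sumr; apply: ler_sum => j _.
Qed.

(** Two jets of the decomposition in one island would make one of them a proper
    jet of that island exchanging finite flow with its complement. *)
Lemma jet_decomposition_limits A pi (p : R) (c : nat) (J : 'I_c -> jet N) :
  (forall t, stochastic (A t)) -> class_ergodic A ->
  absolute_probability_sequence A pi -> 0 < p ->
  (forall t i, p <= pi t i 0) -> jet_decomposition A pi J ->
  exists L : 'I_c -> {set 'I_N}, [set L k | k : 'I_c]%SET = islands A /\
    exists T : nat, forall (t : nat) (k : 'I_c), (T <= t)%N -> J k t = L k.
Proof.
move=> hA eA hpi p0 hp dJ; have [_ hJ _ _] := dJ.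
have hP : class_Pstar A by exists pi => //; exists p.
have A0 t := stochastic_nonneg (hA t).
have /choice[L HL] k := jet_in_island k hA dJ.
have [T _ JL] : \forall t \near \oo, forall k, J k t \subset L k.
  by apply: (filter_forall (F := \oo)) => k; have [] := HL k.
have LA k : L k \in islands A by have [] := HL k.
have JLE t k : (T <= t)%N -> J k t = L k.
  move=> Tt; apply/eqP; rewrite finset.eqEsubset JL //=; apply: contraT.
  move=> /fintype.subsetPn[i iL iJ]; exfalso.
  have [s iJs] := jet_partition_cover hJ t i.
  have ks : k != s by apply: contraNneq iJ => ->.
  have Lks : L s = L k.
    rewrite (island_eq (LA k) iL); apply: (island_eq (LA s)).
    exact: (fintype.subsetP (JL t Tt s)).
  have fL := ergodic_infinite_jet_flow hA hP eA (LA k).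
  apply: (@infinite_jet_flow_tail _ _ A (L k) (J k) T hA fL) => [u Tu|].
    split; first by apply/set0Pn; exact: jet_partition_neq0.
    rewrite properE JL //=; apply/negP => /fintype.subsetP LJ.
    have [j js] := jet_partition_neq0 hJ s u.
    have jk : j \in J k u.
      by apply: LJ; rewrite -Lks; exact: (fintype.subsetP (JL u Tu s)).
    by move/eqP: ks; apply; exact: (jet_partition_disjoint hJ jk js).
  apply/(bounded_sums_shift T (fun u => exchange_ge0 _ _ u hA)).
  have bs : bounded_sums (fun u => \sum_(r | k != r) exchange A (J k) (J r) u).
    apply: bounded_sums_sum => r kr.
    exact: (jet_decomposition_exchange hA hpi p0 hp dJ kr).
  have cov u : jet_compl (L k) (J k) u \subset (\bigcup_(r | k != r) J r u)%SET.
    apply/fintype.subsetP => j; rewrite inE => /andP[jk _].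
    have [r jr] := jet_partition_cover hJ u j.
    by apply/bigcupP; exists r => //; apply: contraNneq jk => ->.
  apply: bounded_sums_le bs => u; rewrite /exchange big_split /=; apply: lerD.
    apply: le_trans (inflow_mono (A0 u) (subxx _) (cov u)) _.
    exact: inflow_bigcupr.
  apply: le_trans (inflow_mono (A0 u) (cov u.+1) (subxx _)) _.
  exact: inflow_bigcupl.
exists L; split; last by exists T.
apply/finset.setP => W; apply/imsetP/idP => [[k _ ->]//|WA].
have [i iW] := island_mem WA; have [k ik] := jet_partition_cover hJ T i.
exists k => //; rewrite (island_eq WA iW); apply/esym/(island_eq (LA k)).
by rewrite -(JLE T).
Qed.

End Decomposition.

(** * Class-ergodicity and infinite jet-flow *)

Theorem theorem4 (R : realType) (N : nat) (A : nat -> 'M[R]_N)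
    (hA : forall t, stochastic (A t)) (hP : class_Pstar A) :
  (class_ergodic A <->
     (forall W : {set 'I_N}, W \in islands A -> infinite_jet_flow A W)) /\
  (class_ergodic A ->
     islands A = ergodic_classes A /\
     (forall pi : nat -> 'cV[R]_N,
        absolute_probability_sequence A pi ->
        uniformly_bounded_away_from_zero pi ->
        (exists (c : nat) (J : 'I_c -> jet N), jet_decomposition A pi J) /\
        (forall (c : nat) (J : 'I_c -> jet N), jet_decomposition A pi J ->
           exists L : 'I_c -> {set 'I_N},
             [/\ [set L k | k : 'I_c]%SET = islands A,
                 forall k, jet_limit (J k) (L k) &
                 exists T : nat, forall (t : nat) (k : 'I_c),
                   (T <= t)%N -> J k t = L k]))).
Proof.
split.
  split; last exact: infinite_jet_flow_ergodic.
  by move=> eA W; exact: ergodic_infinite_jet_flow.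
move=> eA; split; first exact: islands_ergodic_classes.
move=> pi hpi [p p0 hp]; split.
  exists #|islands A|, (fun k _ => enum_val k).
  exact: islands_jet_decomposition hA eA hpi p0 hp.
move=> c J dJ.
have [L [LI [T JL]]] := jet_decomposition_limits hA eA hpi p0 hp dJ.
exists L; split=> //; last by exists T.
by move=> k; exists T => t; exact: JL.
Qed.
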